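(* Let $k\ge 2$. Every $H_\omega$-perfect $k$-uniform hypergraph is $C_\omega$-perfect.
   Context: All hypergraphs are finite. A $k$-uniform hypergraph $G$ has a vertex set $V(G)$ and an edge set $E(G)$ consisting of $k$-element subsets of $V(G)$. For $W\subseteq V(G)$, $G[W]$ is the induced subhypergraph on $W$. A $k$-uniform hypergraph is complete if all $k$-subsets of its vertex set are edges (vacuously so if there are fewer than $k$ vertices), and $\omega(G)$ is the maximum size of $W\subseteq V(G)$ such that $G[W]$ is complete. For $X\subseteq V(G)$ with $|X|<k$, the link $lk_G(X)$ is the $(k-|X|)$-uniform hypergraph with vertex set $V(G)\setminus X$ in which $Y$ is an edge iff $X\cup Y\in E(G)$. A graph is perfect if every induced subgraph has chromatic number equal to its clique number. $G$ is $H$-perfect if $lk_G(X)$ is a perfect graph for every set $X$ of $k-2$ vertices. $G$ is clique friendly if every set of $k+1$ vertices of $G$ spans either exactly $k+1$ edges or at most two edges. $G$ is $H_\omega$-perfect if it is $H$-perfect and clique friendly. A proper $s$-coloring of a $k$-uniform hypergraph $G$ is a coloring of the $(k-1)$-element subsets of $V(G)$ with $s$ colors such that for no edge $F$ of $G$ do all the $(k-1)$-subsets of $F$ receive the same color. For $X\subseteq V(G)$ with $|X|<k-1$, a coloring $c$ of the $(k-1)$-subsets of $V(G)$ restricts to the coloring $Z\mapsto c(X\cup Z)$ of the $(k-1-|X|)$-subsets $Z$ of $V(G)\setminus X=V(lk_G(X))$. $G$ is $C_\omega$-perfect if for every induced subhypergraph $G'$ of $G$ and every $X\subseteq V(G')$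 with $|X|<k-1$, there is a proper $(\omega(G')-k+2)$-coloring of $G'$ that restricts to a proper $(\omega(G')-k+2)$-coloring of $lk_{G'}(X)$. (If $|V(G')|<k-1$ there are no $(k-1)$-subsets to color and the condition is regarded as satisfied.) *)

(* Defs.v *)
From mathcomp Require Import all_boot.

Set Implicit Arguments.
Unset Strict Implicit.
Unset Printing Implicit Defensive.

(* The vertex set is a subset of an ambient finite type, so that induced      *)
(* subhypergraphs and links are again hypergraphs over the same type.         *)
Record hypergraph (T : finType) := Hypergraph {
  vset : {set T};
  eset : {set {set T}}
}.

Section Hypergraphs.

Variable T : finType.
Implicit Types (G : hypergraph T) (W X Y Z F S : {set T}) (k s : nat).

Definition uniform k G : Prop :=
  forall F, F \in eset G -> F \subset vset G /\ #|F| = k.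

(* Only meant for W \subset vset G. *)
Definition induce G W : hypergraph T :=
  Hypergraph W [set F in eset G | F \subset W].

(* Only meant for X \subset vset G. If G is k-uniform, the edges of the link  *)
(* have k - #|X| elements, see uniform_link.                                  *)
Definition link G X : hypergraph T :=
  Hypergraph (vset G :\: X)
    [set Y : {set T} | Y \subset vset G :\: X & X :|: Y \in eset G].

Definition complete k G : bool :=
  [forall F : {set T}, (F \subset vset G) && (#|F| == k) ==> (F \in eset G)].

Definition omega k G : nat :=
  \max_(W : {set T} | (W \subset vset G) && complete k (induce G W)) #|W|.

(* Graphs are 2-uniform hypergraphs. Colours are given to the elements of     *)
(* vset G only, not to all of T: the graph without vertices is 0-colourable.  *)
(* The condition x != y is redundant when G is 2-uniform; it makes the        *)
(* chromatic number total.                                                    *)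
Definition vertex_colorable G s : bool :=
  [exists c : {ffun {x : T | x \in vset G} -> 'I_s},
    [forall x, forall y,
      (x != y) && ([set val x; val y] \in eset G) ==> (c x != c y)]].

Lemma vertex_colorable_ex G : exists s, vertex_colorable G s.
Proof.
exists #|{: {x : T | x \in vset G}}|; apply/existsP; exists (finfun enum_rank).
apply/forallP=> x; apply/forallP=> y; apply/implyP=> /andP[xy _].
by rewrite !ffunE (inj_eq enum_rank_inj).
Qed.

Definition chromatic_number G : nat := ex_minn (vertex_colorable_ex G).

Definition perfect_graph G : Prop :=
  forall W, W \subset vset G ->
    chromatic_number (induce G W) = omega 2 (induce G W).

Definition H_perfect k G : Prop :=
  forall X, X \subset vset G -> #|X| = k - 2 -> perfect_graph (link G X).

Definition clique_friendly k G : Prop :=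
  forall S, S \subset vset G -> #|S| = k.+1 ->
    #|eset (induce G S)| = k.+1 \/ #|eset (induce G S)| <= 2.

Definition H_omega_perfect k G : Prop := H_perfect k G /\ clique_friendly k G.

(* A colouring is a function on all sets, of which only the values at the     *)
(* (k - 1)-subsets of vset G matter; the colours are 0, ..., s - 1.           *)
Definition proper_coloring k s G (c : {set T} -> nat) : Prop :=
  (forall Z, Z \subset vset G -> #|Z| = k - 1 -> c Z < s) /\
  (forall F, F \in eset G ->
     ~ exists a, forall Z, Z \subset F -> #|Z| = k - 1 -> c Z = a).

Definition restrict_coloring (c : {set T} -> nat) X : {set T} -> nat :=
  fun Z => c (X :|: Z).

(* The number omega - k + 2 is written omega + 2 - k because of truncated     *)
(* subtraction; omega_ge shows that no truncation occurs when there are at    *)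
(* least k - 1 vertices. With fewer vertices nothing is coloured and the      *)
(* condition holds trivially, whatever the number of colours: see             *)
(* proper_coloring_small.                                                     *)
Definition C_omega_perfect k G : Prop :=
  forall W, W \subset vset G ->
  forall X, X \subset W -> #|X| < k - 1 ->
  let G' := induce G W in
  let s := omega k G' + 2 - k in
  exists c : {set T} -> nat,
    proper_coloring k s G' c /\
    proper_coloring (k - #|X|) s (link G' X) (restrict_coloring c X).

Lemma uniform_induce k G W : uniform k G -> uniform k (induce G W).
Proof. by move=> uG F; rewrite inE => /andP[/uG[_ ->]]. Qed.

Lemma uniform_link k G X : uniform k G -> uniform (k - #|X|) (link G X).
Proof.
move=> uG Y; rewrite inE => /andP[sYV /uG[_ <-]]; split=> //.
move: sYV; rewrite subsetD => /andP[_ dYX].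
by rewrite cardsU (disjoint_setI0 (_ : [disjoint X & Y])) ?cards0 ?subn0 ?addKn
  // disjoint_sym.
Qed.

Lemma omega_ge k G : 0 < k -> k - 1 <= #|vset G| -> k - 1 <= omega k G.
Proof.
move=> k_gt0 /card_geqP[r [ur sr rV]].
pose W := [set:: r].
have cW : #|W| = k - 1 by rewrite cardsE (card_uniqP ur).
rewrite -cW; apply: (@leq_bigmax_cond _ _ (fun W : {set T} => #|W|)).
apply/andP; split; first by apply/subsetP=> x; rewrite inE; apply: rV.
apply/forallP=> F; apply/implyP=> /andP[/subset_leq_card + /eqP cF] /=.
by rewrite cF cW leqNgt subn1 ltn_predL k_gt0.
Qed.

Lemma proper_coloring_small k s G c : 0 < k -> uniform k G ->
  #|vset G| < k - 1 -> proper_coloring k s G c.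
Proof.
move=> k_gt0 uG small; split=> [Z /subset_leq_card sZ cZ | F /uG[sF cF]].
  by move: small; rewrite ltnNge -cZ sZ.
have := leq_trans (subset_leq_card sF) (ltnW small).
by rewrite cF leqNgt subn1 ltn_predL k_gt0.
Qed.

End Hypergraphs.

(* Main.v *)
Require Import Defs.
From mathcomp Require Import all_boot.
From mathcomp Require Import zify.

(** Every link of a (k-2)-set Y is a perfect graph, so it has a vertex
    colouring with as many colours as its clique number.  Clique friendliness
    bounds that number: a clique of the link of Y, together with Y, spans a
    complete subhypergraph ([complete_link_clique]), so the clique number is at
    most omega - k + 2 ([omega_link_le]).

    To glue these colourings, order the vertices so that those of X come first,
    and give a (k-1)-set with largest vertex z the colour of z in the link of
    the remaining k-2 vertices ([top_coloring]).  If f and g are the two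
    largest vertices of an edge F, then F minus f and F minus g receive the
    colours of g and f in the link of the same set, namely F minus both; there
    f and g are adjacent, so the colours differ.  When F contains X, the two
    largest vertices lie outside X because |X| <= k-2; hence both (k-1)-sets
    contain X, and the restriction to the link of X is proper as well
    ([top_coloring_edge]). *)

Set Implicit Arguments.
Unset Strict Implicit.
Unset Printing Implicit Defensive.

Section CliqueFriendly.

Variable T : finType.
Implicit Types (G : hypergraph T) (A B F S W X Y Z : {set T}) (k s : nat).

(** * Induced subhypergraphs *)

Lemma induce_induce G W S : S \subset W -> induce (induce G W) S = induce G S.
Proof.
move=> sSW; congr Hypergraph; apply/setP=> F; rewrite !inE -andbA.
by case sFS: (F \subset S); rewrite ?andbF // (subset_trans sFS sSW).
Qed.

Lemma link_induce G W X : X \subset W -> W \subset vset G ->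
  link (induce G W) X = induce (link G X) (W :\: X).
Proof.
move=> sXW sWV; congr Hypergraph; apply/setP=> F; rewrite !inE /= subUset sXW.
case sFW: (F \subset W :\: X); last by rewrite andbF.
rewrite (subset_trans sFW (setSD _ sWV)) andbT /=.
by rewrite (subset_trans sFW (subsetDl _ _)) andbT.
Qed.

Lemma H_omega_perfect_induce k G W : W \subset vset G ->
  H_omega_perfect k G -> H_omega_perfect k (induce G W).
Proof.
move=> sWV [hG cG]; split=> [X sXW cX A | S sSW cS].
  rewrite (link_induce sXW sWV) /= => sA; rewrite (induce_induce _ sA).
  apply: (hG X (subset_trans sXW sWV) cX).
  exact: subset_trans sA (setSD _ sWV).
by rewrite (induce_induce _ sSW); apply: cG => //; apply: subset_trans sSW sWV.
Qed.

(** * Cliques in links *)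

(** Three edges rule out the alternative of at most two, so S spans k+1 edges;
    as S has exactly k+1 subsets of size k, each of them is an edge. *)
Lemma clique_friendly_full k G S A :
  uniform k G -> clique_friendly k G -> S \subset vset G -> #|S| = k.+1 ->
  A \subset S -> 2 < #|A| -> (forall a, a \in A -> S :\ a \in eset G) ->
  forall F, F \subset S -> #|F| = k -> F \in eset G.
Proof.
move=> uG cG sSV cS sAS cA eA F sFS cF.
pose D := [set B : {set T} | B \subset S & #|B| == k].
have sED : eset (induce G S) \subset D.
  by apply/subsetP=> B; rewrite !inE => /andP[/uG[_ ->] ->] /=.
have cE : #|eset (induce G S)| = k.+1.
  case: (cG S sSV cS) => // le2; suff: 2 < 2 by [].
  apply: leq_trans cA (leq_trans _ le2).
  rewrite -(card_in_imset (f := fun a => S :\ a) (D := mem A)).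
    apply/subset_leq_card/subsetP=> _ /imsetP[a aA ->].
    by rewrite inE subsetDl eA.
  move=> a b aA bA /setP/(_ a); rewrite !inE eqxx (subsetP sAS _ aA) !andbT.
  by move/esym/negbT; rewrite negbK => /eqP.
have /eqP eED : eset (induce G S) == D.
  by rewrite eqEcard sED cE /D cards_draws cS binSn leqnn.
have : F \in eset (induce G S) by rewrite eED inE sFS cF eqxx.
by rewrite inE => /andP[].
Qed.

(** By induction on the number of vertices of Y that a k-subset F of Y together
    with the clique misses.  If F misses y, it contains at least three clique
    vertices; trading any of them for y gives an edge by induction, so y |: F
    spans three edges, and therefore all k+1 of them. *)
Lemma complete_link_clique k G Y A :
  2 <= k -> uniform k G -> clique_friendly k G ->
  Y \subset vset G -> #|Y| = k - 2 -> A \subset vset G :\: Y ->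
  complete 2 (induce (link G Y) A) -> complete k (induce G (Y :|: A)).
Proof.
move=> k2 uG cG sYV cY sA /forallP compA.
have sAV : A \subset vset G := subset_trans sA (subsetDl _ _).
suff H n F : #|Y :\: F| <= n -> F \subset Y :|: A -> #|F| = k -> F \in eset G.
  apply/forallP=> F; apply/implyP=> /= /andP[sF /eqP cF].
  by rewrite inE sF andbT; apply: H cF.
have split_card B : #|B :&: Y| + #|Y :\: B| = k - 2.
  by rewrite setIC cardsID.
have sDA B : B \subset Y :|: A -> B :\: Y \subset A.
  by rewrite subDset.
elim: n F => [|n IHn] F leF sF cF; have cFY := cardsID Y F;
  have cYF := split_card F.
  have sYF : Y \subset F by rewrite -setD_eq0 -cards_eq0 -leqn0.
  (* F consists of Y and of two clique vertices, which are adjacent. *)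
  have := compA (F :\: Y); rewrite /= sDA //=.
  have -> : #|F :\: Y| == 2 by apply/eqP; lia.
  by rewrite !inE /= => /andP[/andP[_]]; rewrite setDE setUIr setUCr setIT (setUidPr sYF).
have [Y0|[y]] := set_0Vmem (Y :\: F); first by apply: IHn; rewrite ?Y0 ?cards0.
rewrite inE => /andP[yF yY].
have sS : y |: F \subset Y :|: A.
  by rewrite subUset sF andbT sub1set inE yY.
have gt0 : 0 < #|Y :\: F| by apply/card_gt0P; exists y; rewrite inE yF.
apply: (clique_friendly_full uG cG (S := y |: F) (A := F :\: Y)) => //.
- by rewrite (subset_trans sS) // subUset sYV.
- by rewrite cardsU1 yF cF.
- exact: subset_trans (subsetDl _ _) (subsetUr _ _).
- by lia.
- move=> a; rewrite inE => /andP[aY aF].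
  have cS : #|(y |: F) :\ a| = k.
    by have := cardsD1 a (y |: F); rewrite cardsU1 yF cF inE aF orbT => -[].
  apply: IHn => //; last exact: subset_trans (subsetDl _ _) sS.
  rewrite -ltnS; apply: leq_trans leF; apply: proper_card.
  apply/properP; split; last by exists y; rewrite !inE ?yF // eqxx yY
    (contraNneq _ aY) // => <-.
  apply/subsetP=> z; rewrite !inE !negb_and negbK negb_or => /andP[+ zY].
  by case: eqP zY => [-> /(negP aY)|_ -> /andP[_ ->]].
- exact: subsetUr.
Qed.

Lemma omega_link_le k G Y :
  2 <= k -> uniform k G -> clique_friendly k G ->
  Y \subset vset G -> #|Y| = k - 2 -> omega 2 (link G Y) <= omega k G + 2 - k.
Proof.
move=> k2 uG cG sYV cY; apply/bigmax_leqP=> A /andP[sA compA].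
have sU : Y :|: A \subset vset G.
  by rewrite subUset sYV (subset_trans sA (subsetDl _ _)).
suff: #|Y| + #|A| <= omega k G by lia.
have <- : #|Y :|: A| = #|Y| + #|A|.
  apply/eqP; rewrite (leq_card_setU Y A) disjoint_sym.
  by move: sA; rewrite subsetD => /andP[].
apply: (@leq_bigmax_cond _ _ (fun A : {set T} => #|A|)).
by rewrite sU complete_link_clique.
Qed.

Lemma vertex_colorable_fun G s : vertex_colorable G s ->
  exists c : T -> nat, (forall x, x \in vset G -> c x < s) /\
    (forall x y, x \in vset G -> y \in vset G -> x != y ->
       [set x; y] \in eset G -> c x != c y).
Proof.
case/existsP=> c /forallP cP.
exists (fun x => if insub x is Some u then c u : nat else 0); split=> [x xV|x y xV yV].
  by rewrite (insubT (fun x => x \in vset G) xV).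
move=> xy exy; have := cP (Sub x xV) => /forallP/(_ (Sub y yV))/implyP.
by rewrite !insubT -val_eqE /= xy exy; apply.
Qed.

Lemma link_coloring k G Y :
  2 <= k -> uniform k G -> H_omega_perfect k G ->
  Y \subset vset G -> #|Y| = k - 2 ->
  exists c : T -> nat,
    (forall x, x \in vset G :\: Y -> c x < omega k G + 2 - k) /\
    (forall x y, x \notin Y -> y \notin Y -> x != y ->
       y |: (x |: Y) \in eset G -> c x != c y).
Proof.
move=> k2 uG [hG cG] sYV cY; have := hG Y sYV cY _ (subxx _).
rewrite /chromatic_number; case: ex_minnP => m /vertex_colorable_fun[c [c_lt c_ne]] _.
have -> : induce (link G Y) (vset (link G Y)) = link G Y.
  by congr Hypergraph; apply/setP=> F; rewrite !inE /= andbAC andbb.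
move=> m_omega; exists c; split=> [x xV|x y xY yY xy exy].
  by apply: leq_trans (c_lt x xV) _; rewrite m_omega omega_link_le.
have [/subsetP sV _] := uG _ exy.
have xV : x \in vset G :\: Y by rewrite inE xY sV // !inE eqxx orbT.
have yV : y \in vset G :\: Y by rewrite inE yY sV // !inE eqxx.
apply: c_ne => //; rewrite !inE /= subUset !sub1set xV yV /= andbT.
by rewrite setUC -setUA setUCA.
Qed.

(** * Colouring by the largest vertex *)

Section TopColoring.

Variables (r : T -> nat) (col : {set T} -> T -> nat).
Hypothesis r_inj : injective r.

Definition is_top Z z := (z \in Z) && [forall y in Z, r y <= r z].

Definition top_coloring Z : nat :=
  if [pick z | is_top Z z] is Some z then col (Z :\ z) z else 0.

Lemma is_top_ex Z : 0 < #|Z| -> exists z, is_top Z z.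
Proof.
case/card_gt0P=> z0 z0Z; case: (arg_maxnP r z0Z) => z zZ zmax.
by exists z; apply/andP; split=> //; apply/forall_inP.
Qed.

Lemma top_coloringE Z z : is_top Z z -> top_coloring Z = col (Z :\ z) z.
Proof.
rewrite /top_coloring; case: pickP => [y | /(_ z) -> //].
move=> /andP[yZ /forall_inP ymax] /andP[zZ /forall_inP zmax].
by have -> : y = z by apply/r_inj/anti_leq; rewrite zmax // ymax.
Qed.

Lemma is_top_notin X Z z :
  (forall x y, x \in X -> y \notin X -> r x < r y) ->
  #|X| < #|Z| -> is_top Z z -> z \notin X.
Proof.
move=> X_first ltXZ /andP[zZ /forall_inP zmax]; apply/negP=> zX.
have /subsetPn[y yZ yX] : ~~ (Z \subset X).
  by apply: contraL ltXZ => /subset_leq_card; rewrite -leqNgt.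
by have := zmax y yZ; rewrite leqNgt X_first.
Qed.

Lemma top_coloring_lt k G s Z :
  2 <= k ->
  (forall Y x, Y \subset vset G -> #|Y| = k - 2 -> x \in vset G :\: Y ->
     col Y x < s) ->
  Z \subset vset G -> #|Z| = k - 1 -> top_coloring Z < s.
Proof.
move=> k2 col_lt sZ cZ; have [|z topz] := @is_top_ex Z; first by lia.
rewrite (top_coloringE topz); have /andP[zZ _] := topz.
apply: col_lt; first exact: subset_trans (subsetDl _ _) sZ.
  by have := cardsD1 z Z; rewrite zZ; lia.
by rewrite !inE eqxx (subsetP sZ).
Qed.

(** The two subsets are F minus each of its two largest vertices. *)
Lemma top_coloring_edge k G X F :
  2 <= k -> uniform k G ->
  (forall Y x y, Y \subset vset G -> #|Y| = k - 2 -> x \notin Y -> y \notin Y ->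
     x != y -> y |: (x |: Y) \in eset G -> col Y x != col Y y) ->
  (forall x y, x \in X -> y \notin X -> r x < r y) ->
  #|X| < k - 1 -> X \subset F -> F \in eset G ->
  exists Z1 Z2, [/\ X \subset Z1, Z1 \subset F & #|Z1| = k - 1] /\
    [/\ X \subset Z2, Z2 \subset F & #|Z2| = k - 1] /\
    top_coloring Z1 != top_coloring Z2.
Proof.
move=> k2 uG col_ne X_first cX sXF eF; have [sFV cF] := uG _ eF.
have [|f topf] := @is_top_ex F; first by lia.
have /andP[fF /forall_inP fmax] := topf.
have cFf : #|F :\ f| = k - 1 by have := cardsD1 f F; rewrite fF; lia.
have [|g topg] := @is_top_ex (F :\ f); first by lia.
have /andP[] := topg; rewrite in_setD1 => /andP[gf gF] _.
have cFg : #|F :\ g| = k - 1 by have := cardsD1 g F; rewrite gF; lia.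
have topf' : is_top (F :\ g) f.
  rewrite /is_top !inE eq_sym gf fF; apply/forall_inP=> y.
  by rewrite inE => /andP[_ /fmax].
have fX : f \notin X by apply: is_top_notin topf => //; lia.
have gX : g \notin X by apply: is_top_notin topg => //; lia.
exists (F :\ f), (F :\ g); rewrite !subsetD1 sXF fX gX !subsetDl; do 2!split=> //.
rewrite (top_coloringE topg) (top_coloringE topf').
have -> : F :\ g :\ f = F :\ f :\ g by rewrite !setDDl setUC.
apply: col_ne => //; rewrite ?inE ?eqxx ?andbF //.
- by apply: subset_trans sFV; rewrite setDDl subsetDl.
- by have := cardsD1 g (F :\ f); rewrite !inE gf gF; lia.
- by rewrite (setD1K (_ : g \in F :\ f)) ?setD1K // !inE gf.
Qed.

End TopColoring.

Lemma rank_first X : exists r : T -> nat, injective r /\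
  (forall x y, x \in X -> y \notin X -> r x < r y).
Proof.
pose e := enum X ++ enum (~: X).
have eT x : x \in e by rewrite mem_cat !mem_enum inE; case: (x \in X).
exists (index^~ e); split=> [x y exy | x y xX yX].
  by rewrite -(nth_index x (eT x)) exy nth_index.
rewrite !index_cat !mem_enum xX (negPf yX); apply: ltn_addr.
by rewrite index_mem mem_enum.
Qed.

(** * C_omega-perfection *)

Lemma coloring_with_link k G X :
  2 <= k -> uniform k G -> H_omega_perfect k G ->
  X \subset vset G -> #|X| < k - 1 ->
  let s := omega k G + 2 - k in
  exists c : {set T} -> nat, proper_coloring k s G c /\
    proper_coloring (k - #|X|) s (link G X) (restrict_coloring c X).
Proof.
move=> k2 uG pG sXV cX s.
have [r [r_inj X_first]] := rank_first X.
have /fin_all_exists[col colP] Y : exists c : T -> nat,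
    Y \subset vset G -> #|Y| = k - 2 ->
    (forall x, x \in vset G :\: Y -> c x < s) /\
    (forall x y, x \notin Y -> y \notin Y -> x != y ->
       y |: (x |: Y) \in eset G -> c x != c y).
  have [sY|_] := boolP (Y \subset vset G); last by exists (fun=> 0).
  have [cY|cY] := eqVneq #|Y| (k - 2); last first.
    by exists (fun=> 0) => _ /eqP; rewrite (negPf cY).
  by have [c cP] := link_coloring k2 uG pG sY cY; exists c.
have col_lt Y x : Y \subset vset G -> #|Y| = k - 2 -> x \in vset G :\: Y -> col Y x < s.
  by move=> sY cY; have [] := colP Y sY cY; auto.
have col_ne Y x y : Y \subset vset G -> #|Y| = k - 2 -> x \notin Y -> y \notin Y ->
    x != y -> y |: (x |: Y) \in eset G -> col Y x != col Y y.
  by move=> sY cY; have [_] := colP Y sY cY; apply.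
exists (top_coloring r col); split; split.
- by move=> Z; apply: (top_coloring_lt r_inj k2 col_lt).
- move=> F eF [a Fa].
  have [|||Z1 [Z2 [[_ s1 c1] [[_ s2 c2]]]]] :=
    top_coloring_edge (X := set0) r_inj k2 uG col_ne _ _ _ eF.
  + by move=> x y; rewrite inE.
  + by rewrite cards0; lia.
  + exact: sub0set.
  + by rewrite !Fa ?eqxx.
- move=> Z sZ cZ; apply: (top_coloring_lt r_inj k2 col_lt).
    by rewrite subUset sXV (subset_trans sZ (subsetDl _ _)).
  have /eqP -> : #|X :|: Z| == #|X| + #|Z|.
    rewrite (leq_card_setU X Z) disjoint_sym.
    by move: sZ; rewrite subsetD => /andP[].
  by lia.
move=> F; rewrite inE => /andP[_ eF] [a Fa].
have [Z1 [Z2 [[X1 s1 c1] [[X2 s2 c2]]]]] :=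
  top_coloring_edge r_inj k2 uG col_ne X_first cX (subsetUl X F) eF.
(* A set Z containing X is coloured by the restriction as Z minus X. *)
have Za Z : X \subset Z -> Z \subset X :|: F -> #|Z| = k - 1 -> top_coloring r col Z = a.
  move=> sXZ sZ cZ; rewrite -(Fa (Z :\: X)) /restrict_coloring ?subDset //.
    by rewrite setDE setUIr setUCr setIT (setUidPr sXZ).
  by rewrite cardsDS // cZ; lia.
by rewrite !Za ?eqxx.
Qed.

End CliqueFriendly.

Theorem mainTheorem6 (T : finType) (k : nat) (G : hypergraph T) :
  2 <= k -> uniform k G -> H_omega_perfect k G -> C_omega_perfect k G.
Proof.
move=> k2 uG pG W sWV X sXW cX.
apply: coloring_with_link => //; first exact: uniform_induce.
exact: H_omega_perfect_induce.
Qed.
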